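(* Let $X$ be a linearly ordered set (finite or infinite). Let $k,n\geq 3$ be odd natural numbers. Then $\mathrm{med}_k\in\langle\{\mathrm{med}_n\}\rangle$. In other words, a clone on $X$ contains either no median function $\mathrm{med}_m$ ($m\geq 3$ odd) or all of them.
   Context: A clone on $X$ is a set of finitary functions $X^m\to X$ ($m\geq 1$) which contains all projections $\pi^m_i(x_1,\ldots,x_m)=x_i$ ($1\leq i\leq m$) and is closed under composition. For a set $\mathcal F$ of finitary functions on $X$, $\langle\mathcal F\rangle$ is the smallest clone containing $\mathcal F$. For $1\leq k\leq n$, $m^n_k:X^n\to X$ is the function returning the $k$-th smallest element: $m^n_k(x_1,\ldots,x_n)=x_{j_k}$ whenever $\{j_1,\ldots,j_n\}=\{1,\ldots,n\}$ and $x_{j_1}\leq\cdots\leq x_{j_n}$. For odd $n$, the $n$-th median function is $\mathrm{med}_n=m^n_{(n+1)/2}$. *)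

(* Defs.v *)
From mathcomp Require Import all_boot all_order all_fingroup.
From mathcomp Require Import classical_sets.

Set Implicit Arguments.
Unset Strict Implicit.
Unset Printing Implicit Defensive.

Import Order.TTheory.

Local Open Scope classical_set_scope.

(* [arity_gt0] excludes nullary operations: clones here contain only functions
   X ^ m -> X with m >= 1. *)
Record operation (X : Type) := Operation {
  arity : nat;
  arity_gt0 : 0 < arity;
  opfun :> arity.-tuple X -> X
}.

Definition projection (X : Type) (m : nat) (m_gt0 : 0 < m) (i : 'I_m) :
    operation X :=
  Operation m_gt0 (fun x => tnth x i).

Definition composition (X : Type) (f : operation X) (p : nat) (p_gt0 : 0 < p)
    (g : 'I_(arity f) -> p.-tuple X -> X) : operation X :=
  Operation p_gt0 (fun x => f [tuple g i x | i < arity f]).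

Definition is_clone (X : Type) (C : set (operation X)) : Prop :=
  (forall (m : nat) (m_gt0 : 0 < m) (i : 'I_m), C (projection X m_gt0 i)) /\
  (forall (f : operation X) (p : nat) (p_gt0 : 0 < p)
          (g : 'I_(arity f) -> p.-tuple X -> X),
     C f -> (forall i, C (Operation p_gt0 (g i))) -> C (composition p_gt0 g)).

Definition generated_clone (X : Type) (F : set (operation X)) :
    set (operation X) :=
  smallest (@is_clone X) F.

(* Ranks are counted from 0: [order_stat k x] is the (k+1)-st smallest entry
   of x. *)
Definition order_stat (d : Order.disp_t) (X : orderType d) (n : nat) (k : 'I_n)
    (x : n.-tuple X) : X :=
  tnth [tuple of sort <=%O x] k.

Lemma order_statE (d : Order.disp_t) (X : orderType d) (n : nat) (k : 'I_n)
    (x : n.-tuple X) (j : 'S_n) :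
  (forall a b : 'I_n, a <= b -> (tnth x (j a) <= tnth x (j b))%O) ->
  order_stat k x = tnth x (j k).
Proof.
move=> x_j_sorted; rewrite /order_stat.
pose y := [tuple tnth x (j i) | i < n].
have y_sorted : sorted <=%O y.
  apply/(sortedP (tnth y k)) => i; rewrite size_tuple => ltin.
  have lti : i < n by exact: ltnW.
  rewrite -(tnth_nth _ y (Ordinal lti)) -(tnth_nth _ y (Ordinal ltin)).
  by rewrite !tnth_mktuple; exact: x_j_sorted.
have perm_yx : perm_eq y x by apply/tuple_permP; exists j.
have -> : [tuple of sort <=%O x] = y.
  apply/val_inj; rewrite /= -(sorted_sort le_trans y_sorted).
  by apply/esym/perm_sort_leP.
by rewrite tnth_mktuple.
Qed.

Lemma odd_half_ltn (n : nat) : odd n -> n./2 < n.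
Proof. by case: n => // n _; rewrite ltn_half_double -addnn -[X in X < _]addn0 ltn_add2l. Qed.

(* For odd n, rank (n + 1) / 2 counted from 1 is rank n./2 counted from 0. *)
Definition med (d : Order.disp_t) (X : orderType d) (n : nat) (n_odd : odd n) :
    operation X :=
  Operation (odd_gt0 n_odd) (order_stat (Ordinal (odd_half_ltn n_odd))).
Arguments med {d} X {n} n_odd.

(* Main.v *)
Require Import Defs.
From mathcomp Require Import all_boot all_order.
From mathcomp Require Import boolp classical_sets.
From mathcomp Require Import zify.

(** An element [y] of a chain is determined by the set of thresholds [a] with
[a <= y], and applying a median commutes with cutting at a threshold: [a] is
below the median of [x] exactly when a majority of the booleans [a <= x_i] is
true ([med_represents]). So identities between composites of medians over any
chain follow from identities between composites of majorities over the booleans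
([represents_inj]), and the problem becomes one about boolean functions.

There the theorem is an instance of Post's description of the clone of the
ternary majority: it contains every monotone self-dual function
([monotone_self_dual_ind]). Such an [F], if it is not a projection, has at least
three essential variables [i], [j], [k] ([exists_third_variable]), and for every monotone [F]
  F = maj3 (F with x_j := x_i) (F with x_k := x_j) (F with x_i := x_k)
([maj3_identify]), where each of the three functions depends on fewer variables
and is again monotone and self-dual; so induction on the number of variables
applies. Finally, the ternary majority comes from the [n]-ary one, with
[n = 2t+1] and [t > 0], by repeating the arguments [t], [t] and [1] times: any
two of these three blocks hold more than half of the arguments
([majority_three_blocks]). *)

Import Order.TTheory.

Local Open Scope classical_set_scope.

Definition maj3 (a b c : bool) : bool := [|| a && b, b && c | a && c].

(** Comparing [x] and [y] on [A] only makes this say at once that [F] is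
monotone and that it depends on no variable outside [A]. *)
Definition monotone_on {T : finType} (A : {set T}) (F : (T -> bool) -> bool) :=
  forall x y : T -> bool, (forall i, i \in A -> x i -> y i) -> F x -> F y.

Definition self_dual {T : finType} (F : (T -> bool) -> bool) :=
  forall x, F (fun i => ~~ x i) = ~~ F x.

Definition identify {T : finType} (i j : T) (x : T -> bool) : T -> bool :=
  fun l => if l == j then x i else x l.

(** Monotonicity forces the value 1 whenever [x i] is 1, and self-duality
transfers this to the value 0. *)
Lemma dictatorE {T : finType} (A : {set T}) (F : (T -> bool) -> bool) (i : T) :
  monotone_on A F -> self_dual F -> F (pred1 i) ->
  F = (fun x : T -> bool => x i).
Proof.
move=> monoF dualF Fi; apply/funext => x.
have Ftrue (y : T -> bool) : y i -> F y by move=> yi; apply: monoF Fi => l _ /eqP ->.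
case xi: (x i); first exact: Ftrue.
by apply/negbTE; rewrite -dualF Ftrue // xi.
Qed.

(** If [i] and [j] were the only variables of [F], then on them the complement
of [pred1 i] would lie below [pred1 j]; but self-duality gives [F] the value 1 at
the former and [F (pred1 j)] is 0. With [i = j], or with arbitrary indices, this
also yields the second and the first variable. *)
Lemma exists_third_variable {T : finType} (A : {set T}) (F : (T -> bool) -> bool)
    (i j : T) :
  monotone_on A F -> self_dual F -> (forall l, ~~ F (pred1 l)) ->
  exists l, [/\ l \in A, l != i & l != j].
Proof.
move=> monoF dualF no_dict.
case: (pickP [pred l | [&& l \in A, l != i & l != j]]) => [l /and3P lP|none].
  by exists l.
have: F (fun l => ~~ pred1 i l) by rewrite dualF no_dict.
suff le_ij l : l \in A -> ~~ pred1 i l -> pred1 j l.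
  by move/(monoF _ _ le_ij); rewrite (negbTE (no_dict j)).
by move=> lA /= li; apply: contraFT (none l) => lj /=; rewrite lA li.
Qed.

(** Two of the bits [x i], [x j], [x k] agree. The identification that merges
them leaves [x] unchanged; among the other two, the cyclic choice of the
replaced variable makes one raise a bit of [x] and the other lower a bit, or
change nothing. So the three values are [F x], one value above it and one below
it, and their majority is [F x]. *)
Lemma maj3_identify {T : finType} (A : {set T}) (F : (T -> bool) -> bool)
    (i j k : T) (x : T -> bool) :
  monotone_on A F ->
  F x = maj3 (F (identify i j x)) (F (identify j k x)) (F (identify k i x)).
Proof.
move=> monoF.
have below (a b : T) : (x a ==> x b) ==> (F (identify a b x) ==> F x).
  apply/implyP => /implyP xab; apply/implyP; apply: monoF => l _.
  by rewrite /identify; case: eqP => [->|].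
have above (a b : T) : (x b ==> x a) ==> (F x ==> F (identify a b x)).
  apply/implyP => /implyP xba; apply/implyP; apply: monoF => l _.
  by rewrite /identify; case: eqP => [->|].
move: (below i j) (below j k) (below k i) (above i j) (above j k) (above k i).
by case: (x i); case: (x j); case: (x k); do 4 case: (F _).
Qed.

Lemma monotone_identify {T : finType} (A : {set T}) (F : (T -> bool) -> bool)
    (i j : T) :
  i \in A -> i != j -> monotone_on A F ->
  monotone_on (A :\ j) (fun x => F (identify i j x)).
Proof.
move=> iA ij monoF x y le_xy; apply: monoF => l lA; rewrite /identify.
by case: eqP => [_|/eqP lj]; apply: le_xy; rewrite !inE ?ij ?lj.
Qed.

Lemma self_dual_identify {T : finType} (F : (T -> bool) -> bool) (i j : T) :
  self_dual F -> self_dual (fun x => F (identify i j x)).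
Proof.
move=> dualF x; rewrite -dualF; congr F; apply/funext => l.
by rewrite /identify; case: eqP.
Qed.

(** Post's theorem for the ternary majority, as an induction principle for
monotone self-dual functions. The induction is on the size of the set of
variables on which the function may depend. *)
Lemma monotone_self_dual_ind {T : finType} (P : ((T -> bool) -> bool) -> Prop) :
  (forall i, P (fun x : T -> bool => x i)) ->
  (forall F G H, P F -> P G -> P H -> P (fun x => maj3 (F x) (G x) (H x))) ->
  forall (A : {set T}) (F : (T -> bool) -> bool),
    monotone_on A F -> self_dual F -> P F.
Proof.
move=> Pproj Pmaj A; have [m] := ubnP #|A|; elim: m A => // m IHm A leAm F monoF dualF.
case: (pickP (fun i => F (pred1 i))) => [i /(dictatorE _ _ _ monoF dualF) -> //|].
move=> nodict0; have nodict l : ~~ F (pred1 l) by rewrite nodict0.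
have third i j := exists_third_variable _ _ i j monoF dualF nodict.
case: (set_0Vmem A) => [A0|[i iA]].
  (* A constant function is not self-dual. *)
  have /monoF mono0: forall l, l \in A -> xpred0 l -> ~~ xpred0 l by [].
  have /monoF mono1: forall l, l \in A -> ~~ xpred0 l -> xpred0 l.
    by move=> l; rewrite A0 inE.
  by move: mono0 mono1; rewrite dualF; case: (F _) => [/(_ isT)|_ /(_ isT)].
have [j [jA ji _]] := third i i; have [k [kA ki kj]] := third i j.
have Pid a b : a \in A -> b \in A -> a != b -> P (fun x => F (identify a b x)).
  move=> aA bA ab; apply: IHm (monotone_identify _ _ _ _ aA ab monoF) _.
    by move: leAm; rewrite (cardsD1 b A) bA.
  exact: self_dual_identify.
have -> : F = fun x =>
    maj3 (F (identify i j x)) (F (identify j k x)) (F (identify k i x)).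
  by apply/funext => x; exact: maj3_identify monoF.
by apply: Pmaj; apply: Pid; rewrite // eq_sym.
Qed.

Definition majority {n : nat} (x : 'I_n -> bool) : bool :=
  n./2 < \sum_(i < n) x i.

Lemma majority_monotone (n : nat) : monotone_on [set: 'I_n] majority.
Proof.
move=> x y le_xy; rewrite /majority => /leq_trans; apply; apply: leq_sum => i _.
by move: (le_xy i (finset.in_setT i)); case: (x i) => // ->.
Qed.

Lemma majority_self_dual (n : nat) : odd n -> self_dual (@majority n).
Proof.
move=> n_odd x; rewrite /majority.
have : \sum_(i < n) x i + \sum_(i < n) ~~ x i = n.
  rewrite -big_split /= (eq_bigr (fun=> 1)) ?sum1_card ?card_ord // => i _.
  by case: (x i).
have := odd_double_half n; rewrite n_odd; lia.
Qed.

(** Each of the first two blocks has [n./2] elements and the last has one, so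
a set of blocks has more than [n./2] elements exactly when it contains two of
them; for this the first two must be nonempty, hence [3 <= n]. *)
Lemma majority_three_blocks (n : nat) (a b c : bool) : odd n -> 3 <= n ->
  majority (fun i : 'I_n => if i < n./2 then a else if i < n./2.*2 then b else c)
  = maj3 a b c.
Proof.
move=> n_odd n_ge3; rewrite /majority.
pose s i : bool := if i < n./2 then a else if i < n./2.*2 then b else c.
rewrite -(big_mkord xpredT (fun i => s i : nat)) /=.
have nE : n = n./2.*2.+1 by have := odd_double_half n; rewrite n_odd; lia.
have block u v (w : bool) : u <= v -> (forall i, u <= i < v -> s i = w) ->
    \sum_(u <= i < v) s i = (v - u) * w.
  move=> uv sw; rewrite (eq_big_nat _ _ (F2 := fun=> w : nat)).
    by rewrite sum_nat_const_nat.
  by move=> i /sw ->.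
rewrite (big_cat_nat _ (n := n./2)) /=; [|lia|lia].
rewrite (big_cat_nat _ (m := n./2) (n := n./2.*2)) /=; [|lia|lia].
rewrite (block 0 n./2 a) ?(block n./2 n./2.*2 b) ?(block n./2.*2 n c); try lia.
- by rewrite /maj3 {s block}; case: a; case: b; case: c => /=; rewrite ?muln0 ?muln1; lia.
- by move=> i ?; rewrite /s !ifF //; lia.
- by move=> i ?; rewrite /s ifF ?ifT //; lia.
- by move=> i ?; rewrite /s ifT //; lia.
Qed.

(** The boolean functions [fun i => a <= tnth x i] are the cuts of [x] at the
thresholds [a]; [f] is represented when it acts on every cut by the same [F]. *)
Definition represents {d : Order.disp_t} {X : orderType d} {p : nat}
    (f : p.-tuple X -> X) (F : ('I_p -> bool) -> bool) : Prop :=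
  forall x a, (a <= f x)%O = F (fun i => (a <= tnth x i)%O).

(** Each of [f x] and [g x] is a threshold below itself, hence below the
other one. *)
Lemma represents_inj {d : Order.disp_t} {X : orderType d} {p : nat}
    (f g : p.-tuple X -> X) (F : ('I_p -> bool) -> bool) :
  represents f F -> represents g F -> f = g.
Proof.
move=> fF gF; apply/funext => x; apply/le_anti.
by rewrite gF -fF lexx fF -gF lexx.
Qed.

(** The entries at or above [a] form the end of the sorted list, which contains
the middle position exactly when it has more than [n./2] elements. *)
Lemma med_represents {d : Order.disp_t} {X : orderType d} {n : nat}
    (n_odd : odd n) :
  represents (med X n_odd : n.-tuple X -> X) majority.
Proof.
move=> x a; rewrite /= /order_stat /majority.
have -> : \sum_(i < n) (a <= tnth x i)%O = count (>= a)%O (sort <=%O x).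
  rewrite (permP (permEl (perm_sort _ _))) -sum1_count big_tuple.
  by rewrite [RHS]big_mkcond; apply: eq_bigr => i _; case: (a <= _)%O.
rewrite (tnth_nth a) /=.
have sz : size (sort <=%O x) = n by rewrite size_sort size_tuple.
have half := odd_double_half n; rewrite n_odd in half.
have := sort_le_sorted x.
move: (sort _ _) sz => s sz s_sorted.
have := count_lt_ge a s; have := count_size (>= a)%O s; rewrite sz => le_n ltE.
have [n_lt|n_ge] := ltnP n./2 (count (>= a)%O s).
  by apply: nth_count_ge => //; rewrite sz ltE; lia.
by apply/negbTE; rewrite -ltNge; apply: nth_count_lt => //; rewrite ltE; lia.
Qed.

Definition represented_in {d : Order.disp_t} {X : orderType d}
    (C : set (operation X)) {p : nat} (p_gt0 : 0 < p)
    (F : ('I_p -> bool) -> bool) : Prop :=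
  exists2 f : p.-tuple X -> X, C (Operation p_gt0 f) & represents f F.

(** Composing the [n]-th median with copies of [f], [g] and [h] in blocks of
sizes [n./2], [n./2] and 1 replaces the ternary median. *)
Lemma represented_maj3 {d : Order.disp_t} {X : orderType d}
    (C : set (operation X)) (n p : nat) (n_odd : odd n) (p_gt0 : 0 < p)
    (F G H : ('I_p -> bool) -> bool) :
  is_clone C -> C (med X n_odd) -> 3 <= n ->
  represented_in C p_gt0 F -> represented_in C p_gt0 G ->
  represented_in C p_gt0 H ->
  represented_in C p_gt0 (fun x => maj3 (F x) (G x) (H x)).
Proof.
move=> [_ C_comp] C_med n_ge3 [f Cf fF] [g Cg gG] [h Ch hH].
pose u (i : 'I_n) := if i < n./2 then f else if i < n./2.*2 then g else h.
exists (composition (f := med X n_odd) p_gt0 u : p.-tuple X -> X).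
  by apply: (C_comp (med X n_odd)) => // i; rewrite /u; do 2?case: ifP.
move=> x a; rewrite [LHS]med_represents -fF -gG -hH.
rewrite -(majority_three_blocks n) //; congr majority; apply/funext => i.
by rewrite tnth_mktuple /u; do 2?case: ifP.
Qed.

(** The boolean majority of [k] bits is monotone and self-dual, so some member
of [C] represents it; the [k]-th median is the only function that does. *)
Lemma clone_med {d : Order.disp_t} {X : orderType d} (C : set (operation X))
    (k n : nat) (k_odd : odd k) (n_odd : odd n) :
  is_clone C -> 3 <= n -> C (med X n_odd) -> C (med X k_odd).
Proof.
move=> C_clone n_ge3 C_med.
have [f Cf f_maj] : represented_in C (odd_gt0 k_odd) majority.
  apply: monotone_self_dual_ind (majority_monotone k) (majority_self_dual k k_odd).
    move=> i; exists (fun x : k.-tuple X => tnth x i) => //.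
    by case: C_clone => C_proj _; exact: (C_proj k (odd_gt0 k_odd) i).
  by move=> F G H; exact: represented_maj3 C_clone C_med n_ge3.
suff -> : med X k_odd = Operation (odd_gt0 k_odd) f by [].
by rewrite (represents_inj _ _ _ f_maj (med_represents k_odd)).
Qed.

Theorem theorem2 (d : Order.disp_t) (X : orderType d) :
  (forall (k n : nat) (k_odd : odd k) (n_odd : odd n),
     3 <= k -> 3 <= n ->
     generated_clone [set med X n_odd] (med X k_odd)) /\
  (forall C : set (operation X), is_clone C ->
     (forall (m : nat) (m_odd : odd m), 3 <= m -> ~ C (med X m_odd)) \/
     (forall (m : nat) (m_odd : odd m), 3 <= m -> C (med X m_odd))).
Proof.
split=> [k n k_odd n_odd _ n_ge3 C [C_clone C_gen] | C C_clone].
  by apply: (clone_med C k n) => //; exact: C_gen.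
have [[n [n_odd [n_ge3 C_med]]]|none] := pselect (exists n (n_odd : odd n),
    3 <= n /\ C (med X n_odd)); [right | left] => m m_odd m_ge3.
  exact: (clone_med C m n).
by move=> C_m; apply: none; exists m, m_odd.
Qed.
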